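(* Let $\alpha\neq0$. The fixed points $\vartheta=\vartheta_0=\mathrm{const}$, $p_\vartheta=0$ of the reduced system (the permanent rotations) correspond to the rolling of the ellipsoid in a circle with a constant inclination angle of the symmetry axis, $\vartheta_0$. The point of contact traces out a circle of radius $$\rho_p=\frac{\beta^2}{Z(\vartheta_0)}\tan\vartheta_0,$$ and the center of mass traces out a circle of radius $$\rho_c=Z(\vartheta_0)\tan\vartheta_0+\alpha\sin\vartheta_0,$$ where $Z(\vartheta)=\sqrt{\beta^2\sin^2\vartheta+\cos^2\vartheta}$.
   Context: Setting: a dynamically symmetric ellipsoid of revolution rolls on a horizontal plane without slipping and without spinning about the vertical. Units are dimensionless: the mass unit is the body's mass $m$, the length unit is the semiaxis $b_3$ along the symmetry axis, the time unit is $\sqrt{b_3/\mathrm g}$. Parameters: $\alpha=a/b_3\in[0,1]$ ($a$ is the displacement of the center of mass from the geometric center along the symmetry axis), $\beta=b_1/b_3\in(0,\infty)$ ($b_1$ the equatorial semiaxis), $\nu=i_3/i_1\in(0,2]$, $\eta=mb_3^2/i_1\in(0,\infty)$, where $\operatorname{diag}(i_1,i_1,i_3)$ is the principal central inertia tensor; in dimensionless units it is $\mathbf I=\operatorname{diag}(1/\eta,1/\eta,\nu/\eta)$. Vectors are written in a body-fixed frame with origin at the center of mass and third basis vector $\boldsymbol e_3$ along the symmetry axis. $\boldsymbol\omega=(\omega_1,\omega_2,\omega_3)$ is the angular velocity; $\boldsymbol a,\boldsymbol b,\boldsymbol\gamma$ are the unit vectors of the fixed frame $Oxyz$ ($\boldsymbol\gamma$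 vertical) and $\mathbf Q\in SO(3)$ is the matrix with columns $\boldsymbol a,\boldsymbol b,\boldsymbol\gamma$. The vector from the center of mass to the contact point is $$\boldsymbol r(\boldsymbol\gamma)=-\frac{(\beta^2\gamma_1,\beta^2\gamma_2,\gamma_3)}{\sqrt{\beta^2(\gamma_1^2+\gamma_2^2)+\gamma_3^2}}-\alpha\boldsymbol e_3 .$$ With $\mathbf J=\mathbf I+|\boldsymbol r|^2\mathbf E_3-\boldsymbol r\otimes\boldsymbol r$ ($\mathbf E_3$ the identity matrix), the equations of motion are $$\mathbf J\dot{\boldsymbol\omega}+\boldsymbol\omega\times\mathbf J\boldsymbol\omega+\boldsymbol r\times(\boldsymbol\omega\times\dot{\boldsymbol r})+\boldsymbol\gamma\times\boldsymbol r-\mu\boldsymbol\gamma=0,\quad \dot{\boldsymbol a}=\boldsymbol a\times\boldsymbol\omega,\ \dot{\boldsymbol b}=\boldsymbol b\times\boldsymbol\omega,\ \dot{\boldsymbol\gamma}=\boldsymbol\gamma\times\boldsymbol\omega,$$ with $\mu$ the multiplier ensuring the no-spin constraint $(\boldsymbol\omega,\boldsymbol\gamma)=0$. The position $\boldsymbol r_c=(x_c,y_c,z_c)$ of the center of mass in the fixed frame satisfies $\dot{\boldsymbol r}_c=\mathbf Q^{\top}\boldsymbol v$ with $\boldsymbol v=-\boldsymbol\omega\times\boldsymbol r$ (no slip) and $z_c=-(\boldsymbol r,\boldsymbol\gamma)$; the contact point has fixed-frame coordinates $x_p=x_c+(\boldsymbol r,\boldsymbol a)$, $y_p=y_c+(\boldsymbol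 r,\boldsymbol b)$, $z_p=0$. Put $\boldsymbol\gamma=(\sin\vartheta\sin\varphi,\sin\vartheta\cos\varphi,\cos\vartheta)$; $\vartheta$ is the nutation angle and $\varphi$ the angle of proper rotation. The quantity $\mathcal F_2=J(\vartheta)\,\omega_3$ with $J(\vartheta)=\sqrt{\tfrac1\eta(\cos^2\vartheta+\nu\sin^2\vartheta)+(Z(\vartheta)+\alpha\cos\vartheta)^2}$ is a first integral. On the level $\mathcal F_2=\kappa$, $(\boldsymbol\omega,\boldsymbol\gamma)=0$, $|\boldsymbol\gamma|=1$ the system reduces to the ''reduced system'' $$\dot\vartheta=p_\vartheta,\qquad \dot p_\vartheta=\frac1{B(\vartheta)}\Big(\frac{\kappa^2\cot\vartheta}{\sin^2\vartheta}-\frac{B'(\vartheta)}2p_\vartheta^2+\alpha\sin\vartheta+\frac{(1-\beta^2)\sin\vartheta\cos\vartheta}{Z(\vartheta)}\Big),\qquad B(\vartheta)=\frac1\eta+|\boldsymbol r|^2 .$$ Permanent rotations are the solutions $\vartheta=\vartheta_0=\mathrm{const}$, $\varphi=\varphi_0+\frac{\omega_0}{\sin\vartheta_0}t$, where $$\omega_0^2=\frac{-\eta\sin^2\vartheta_0\,\big((1-\beta^2)\cos\vartheta_0+\alpha Z(\vartheta_0)\big)}{\cos\vartheta_0\, Z(\vartheta_0)\,\big(\eta(Z(\vartheta_0)+\alpha\cos\vartheta_0)^2+\cos^2\vartheta_0+\nu\sin^2\vartheta_0\big)},$$ and the range of $\vartheta_0$ is determined by the condition that this expression be nonnegative. In the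 reduced system they correspond to a one-parameter family of fixed points $\vartheta=\vartheta_0$, $p_\vartheta=0$; this is the family of fixed points meant in the claim.
   Formalization: The radii are taken as |ρ_p| and |ρ_c|, since both formulas are negative when cos ϑ0 < 0; and the circles are claimed to be fully traced only when ω0 ≠ 0, since for ω0 = 0 the body is at rest. *)

(* Defs.v *)
From HB Require Import structures.
From mathcomp Require Import all_boot all_order all_algebra.
From mathcomp Require Import all_classical all_reals all_analysis.

Set Implicit Arguments.
Unset Strict Implicit.
Unset Printing Implicit Defensive.

Import Order.TTheory GRing.Theory Num.Theory.
Import numFieldNormedType.Exports.

Local Open Scope classical_set_scope.
Local Open Scope ring_scope.

Section Vectors.
Variable R : realType.
Implicit Types u v w : 'cV[R]_3.

Definition vec3 (x y z : R) : 'cV[R]_3 := \col_i [:: x; y; z]`_i.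

Definition e3 : 'cV[R]_3 := vec3 0 0 1.

(* The library norm on matrices is the sup norm, so Euclidean lengths are
   always written through [dot]. *)
Definition dot u v : R := (u^T *m v) 0 0.

Definition cross u v : 'cV[R]_3 :=
  vec3 (u 1 0 * v 2 0 - u 2 0 * v 1 0)
       (u 2 0 * v 0 0 - u 0 0 * v 2 0)
       (u 0 0 * v 1 0 - u 1 0 * v 0 0).

Definition columns u v w : 'M[R]_3 := \matrix_(i, j) [:: u i 0; v i 0; w i 0]`_j.

Definition horizontal_circle (c : 'cV[R]_3) (rho : R) : set 'cV[R]_3 :=
  [set p | p 2 0 = c 2 0 /\
           Num.sqrt ((p 0 0 - c 0 0) ^+ 2 + (p 1 0 - c 1 0) ^+ 2) = rho].

End Vectors.

Section Ellipsoid.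
Variables (R : realType) (alpha beta nu eta : R).

Definition inertia : 'M[R]_3 :=
  diag_mx (vec3 (1 / eta) (1 / eta) (nu / eta))^T.

(* From the center of mass to the contact point, in the body frame. *)
Definition rvec (g : 'cV[R]_3) : 'cV[R]_3 :=
  - ((Num.sqrt (beta ^+ 2 * (g 0 0 ^+ 2 + g 1 0 ^+ 2) + g 2 0 ^+ 2))^-1 *:
       vec3 (beta ^+ 2 * g 0 0) (beta ^+ 2 * g 1 0) (g 2 0))
  - alpha *: e3 R.

Definition Jtensor (r : 'cV[R]_3) : 'M[R]_3 :=
  inertia + (dot r r)%:M - r *m r^T.

Definition Zfun (th : R) : R :=
  Num.sqrt (beta ^+ 2 * sin th ^+ 2 + cos th ^+ 2).

Definition Jfun (th : R) : R :=
  Num.sqrt (1 / eta * (cos th ^+ 2 + nu * sin th ^+ 2)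
            + (Zfun th + alpha * cos th) ^+ 2).

Definition gamma_of (th phi : R) : 'cV[R]_3 :=
  vec3 (sin th * sin phi) (sin th * cos phi) (cos th).

(* |r|^2 does not depend on phi, so it is evaluated at phi = 0. *)
Definition Bfun (th : R) : R :=
  1 / eta + dot (rvec (gamma_of th 0)) (rvec (gamma_of th 0)).

(* omega, a, b, gamma are resolved in the body frame, the position of the
   center of mass in the fixed frame. *)
Record trajectory := Trajectory {
  omega : R -> 'cV[R]_3;
  vec_a : R -> 'cV[R]_3;
  vec_b : R -> 'cV[R]_3;
  vec_gamma : R -> 'cV[R]_3;
  com : R -> 'cV[R]_3;
  multiplier : R -> R
}.

Definition contact_arm (M : trajectory) (t : R) : 'cV[R]_3 := rvec (vec_gamma M t).

Definition attitude (M : trajectory) (t : R) : 'M[R]_3 :=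
  columns (vec_a M t) (vec_b M t) (vec_gamma M t).

Definition dynamics (M : trajectory) : Prop := forall t : R,
  let w := omega M t in
  let r := contact_arm M t in
  let g := vec_gamma M t in
  derivable (omega M) t 1 /\
  Jtensor r *m derive1 (omega M) t + cross w (Jtensor r *m w)
    + cross r (cross w (derive1 (contact_arm M) t)) + cross g r - multiplier M t *: g = 0.

Definition no_spin (M : trajectory) : Prop :=
  forall t : R, dot (omega M t) (vec_gamma M t) = 0.

Definition kinematics (M : trajectory) : Prop := forall t : R,
  [/\ (attitude M t)^T *m attitude M t = 1%:M,
      \det (attitude M t) = 1,
      is_derive t 1 (vec_a M) (cross (vec_a M t) (omega M t)),
      is_derive t 1 (vec_b M) (cross (vec_b M t) (omega M t)) &
      is_derive t 1 (vec_gamma M) (cross (vec_gamma M t) (omega M t))].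

Definition rolling (M : trajectory) : Prop := forall t : R,
  is_derive t 1 (com M)
    ((attitude M t)^T *m (- cross (omega M t) (contact_arm M t))) /\
  com M t 2 0 = - dot (contact_arm M t) (vec_gamma M t).

Definition motion (M : trajectory) : Prop :=
  [/\ dynamics M, no_spin M, kinematics M & rolling M].

Definition contact_point (M : trajectory) (t : R) : 'cV[R]_3 :=
  vec3 (com M t 0 0 + dot (contact_arm M t) (vec_a M t))
       (com M t 1 0 + dot (contact_arm M t) (vec_b M t))
       0.

(* The angle th in [0, pi] with gamma = gamma_of th phi for some phi. *)
Definition nutation (M : trajectory) (t : R) : R := acos (vec_gamma M t 2 0).

Definition F2 (M : trajectory) (t : R) : R :=
  Jfun (nutation M t) * omega M t 2 0.

Definition reduced_state (M : trajectory) (t : R) : R * R :=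
  (nutation M t, derive1 (nutation M) t).

Definition reduced_field (kappa : R) (s : R * R) : R * R :=
  let: (th, p) := s in
  (p, (Bfun th)^-1 *
      (kappa ^+ 2 * (cos th / sin th) / sin th ^+ 2
       - derive1 Bfun th / 2 * p ^+ 2
       + alpha * sin th
       + (1 - beta ^+ 2) * sin th * cos th / Zfun th)).

Definition reduced_fixed_point (kappa : R) (s : R * R) : Prop :=
  reduced_field kappa s = (0, 0).

(* [M] is a motion on the level F2 = kappa whose image in the reduced system
   stays at the point [s]. *)
Definition motion_over (kappa : R) (s : R * R) (M : trajectory) : Prop :=
  [/\ motion M, forall t, F2 M t = kappa & forall t, reduced_state M t = s].

(* The squared parameter omega_0^2 of the permanent rotation of inclination
   th. *)
Definition omega0_sq (th : R) : R :=
  (- eta * sin th ^+ 2 * ((1 - beta ^+ 2) * cos th + alpha * Zfun th))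
  / (cos th * Zfun th *
     (eta * (Zfun th + alpha * cos th) ^+ 2 + cos th ^+ 2 + nu * sin th ^+ 2)).

Definition rho_p (th : R) : R := beta ^+ 2 / Zfun th * tan th.

Definition rho_c (th : R) : R := Zfun th * tan th + alpha * sin th.

End Ellipsoid.

(* Main.v *)
Require Import Defs.
From mathcomp Require Import all_boot all_order all_algebra.
From mathcomp Require Import all_classical all_reals all_analysis.
From mathcomp Require Import ring.
Import Order.TTheory GRing.Theory Num.Theory.
Import numFieldNormedType.Exports.
Local Open Scope classical_set_scope.
Local Open Scope ring_scope.

(** Write g for the vertical unit vector and e3 for the symmetry axis, both in
the body frame, and c = cos th0.  If the inclination is constant, the absence
of spin and the value of the first integral leave only one angular velocity,
w = Phi (e3 - c g) with Phi = kappa / (J sin^2 th0): the body turns about its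
axis while the axis precesses about the vertical ([motion_over_steady]).

For such a motion the derivatives of w and of the contact arm are multiples of
the horizontal vector g x e3, and so is every term of the equation of motion
except the reaction -mu g.  Hence the dynamics forces one scalar, [balance], to
vanish ([gyroscopic_residual], [steady_dynamics_balance]).  The force of the
reduced system is -sin th0 times this scalar ([reduced_fixed_pointP]), so a
motion of constant inclination exists only over a fixed point.  Conversely,
over a fixed point the steady precession with mu = 0, written with Euler
angles, is a motion ([precessing_motionP]).  Since alpha <> 0, a fixed point
has c <> 0, and solving [balance] = 0 for Phi^2 gives the formula for omega_0^2
with omega_0 = Phi sin th0 ([balance_omega0_sq]).

The circles come from the horizontal projection (a_3, b_3) of e3.  It rotates
uniformly at the rate c Phi on the circle of radius sin th0 ([steady_axis]).
The velocity of the center of mass is h / c times the velocity of (a_3, b_3),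
where h = Z + alpha c is the height of the center ([steady_com]).  So the center
of mass moves on a circle of radius h |tan th0|.  The contact point is
displaced from it horizontally by a multiple of (a_3, b_3), which changes the
factor h / c to beta^2 / (Z c) and gives the other radius ([steady_circles]).
If Phi <> 0 the rotation runs through every angle and the circles are covered
completely. *)

(** * Vectors of dimension three *)

Section Vec3.
Set Implicit Arguments.
Unset Strict Implicit.
Variable R : realType.
Implicit Types (u v w : 'cV[R]_3) (x y z : R).

Lemma vec3E x y z :
  ((vec3 x y z 0 0 = x) * (vec3 x y z 1 0 = y) * (vec3 x y z 2 0 = z))%type.
Proof. by rewrite !mxE. Qed.

Lemma forall_ord3 (P : 'I_3 -> Prop) : P 0 -> P 1 -> P 2 -> forall i, P i.
Proof.
move=> P0 P1 P2 [[|[|[|//]]] i3].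
- by rewrite (_ : Ordinal i3 = 0)//; exact: val_inj.
- by rewrite (_ : Ordinal i3 = 1)//; exact: val_inj.
- by rewrite (_ : Ordinal i3 = 2)//; exact: val_inj.
Qed.

Lemma col3P u v : u 0 0 = v 0 0 -> u 1 0 = v 1 0 -> u 2 0 = v 2 0 -> u = v.
Proof.
move=> E0 E1 E2; apply/matrixP => i j; rewrite (ord1 j).
by move: i; exact: forall_ord3.
Qed.

Lemma big_ord3 (F : 'I_3 -> R) : \sum_i F i = F 0 + F 1 + F 2.
Proof.
rewrite !big_ord_recl big_ord0 addr0 addrA.
by do 2?[congr (_ + _)]; congr F; exact: val_inj.
Qed.

Lemma mulmx3E m n (M : 'M[R]_(m, 3)) (N : 'M[R]_(3, n)) i j :
  (M *m N) i j = M i 0 * N 0 j + M i 1 * N 1 j + M i 2 * N 2 j.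
Proof. by rewrite mxE big_ord3. Qed.

Lemma dotE u v : dot u v = u 0 0 * v 0 0 + u 1 0 * v 1 0 + u 2 0 * v 2 0.
Proof. by rewrite /dot mulmx3E !mxE. Qed.

Lemma crossE u v :
  ((cross u v 0 0 = u 1 0 * v 2 0 - u 2 0 * v 1 0) *
   (cross u v 1 0 = u 2 0 * v 0 0 - u 0 0 * v 2 0) *
   (cross u v 2 0 = u 0 0 * v 1 0 - u 1 0 * v 0 0))%type.
Proof. by rewrite !vec3E. Qed.

Lemma e3E : ((e3 R 0 0 = 0) * (e3 R 1 0 = 0) * (e3 R 2 0 = 1))%type.
Proof. by rewrite !vec3E. Qed.

Lemma dot_ge0 u : 0 <= dot u u.
Proof. by rewrite dotE -!expr2 !addr_ge0// sqr_ge0. Qed.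

Lemma dotvv_eq0 u : dot u u = 0 -> u = 0.
Proof.
rewrite dotE -!expr2 => /eqP.
rewrite !paddr_eq0 ?addr_ge0 ?sqr_ge0// !sqrf_eq0.
by move=> /andP[/andP[/eqP E0 /eqP E1] /eqP E2]; apply: col3P; rewrite mxE.
Qed.

(** [mxE] comes last: it would unfold [cross] and [vec3] into list accesses. *)
Definition linE := (crossE, vec3E, e3E, dotE, mulmx3E, mxE).

Lemma det_columns u v w : \det (columns u v w) = dot v (cross w u).
Proof.
rewrite (expand_det_row _ 0) big_ord3 /cofactor.
rewrite !(expand_det_row _ ord0) !big_ord_recl !big_ord0 /cofactor !det_mx11.
have E1 : lift 0 (0 : 'I_2) = 1 :> 'I_3 by exact: val_inj.
have E2 : lift 0 (1 : 'I_2) = 2 :> 'I_3 by exact: val_inj.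
have E3 : lift ord0 (0 : 'I_1) = 1 :> 'I_2 by exact: val_inj.
rewrite !mxE !E3 !E1 !E2 dotE !crossE /=.
rewrite !expr0 !expr1 expr2 /=; ring.
Qed.

(** The third vector of a positively oriented orthonormal frame is the cross
    product of the first two, read cyclically: the difference has zero
    Euclidean length, by Lagrange's identity. *)
Lemma orthonormal_cross u v w :
  dot u u = 1 -> dot v v = 1 -> dot u v = 0 -> dot w w = 1 ->
  dot w (cross u v) = 1 -> w = cross u v.
Proof.
move=> uu vv uv ww wuv; apply/eqP; rewrite -subr_eq0; apply/eqP/dotvv_eq0.
have -> : dot (w - cross u v) (w - cross u v) =
   dot w w - dot w (cross u v) *+ 2 + (dot u u * dot v v - dot u v ^+ 2).
  by rewrite !linE; ring.
by rewrite uu vv uv ww wuv; ring.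
Qed.

Lemma orthonormal_columns u v w :
  (columns u v w)^T *m columns u v w = 1%:M ->
  [/\ dot u u = 1, dot v v = 1 & dot w w = 1] /\
  [/\ dot u v = 0, dot u w = 0 & dot v w = 0].
Proof.
move=> /matrixP H.
split; split; [move: (H 0 0)|move: (H 1 1)|move: (H 2 2)
              |move: (H 0 1)|move: (H 0 2)|move: (H 1 2)].
all: by rewrite mulmx3E !mxE /= dotE.
Qed.

(** Both identities are cyclic readings of the determinant as a triple
    product. *)
Lemma frame_cross u v w :
  (columns u v w)^T *m columns u v w = 1%:M -> \det (columns u v w) = 1 ->
  u = cross v w /\ v = cross w u.
Proof.
move=> /orthonormal_columns[[uu vv ww] [uv uw vw]]; rewrite det_columns => D.
have dotC (p q : 'cV[R]_3) : dot p q = dot q p by rewrite !dotE; ring.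
split; apply: orthonormal_cross => //; last by rewrite dotC.
by apply: etrans D; rewrite !linE; ring.
Qed.

End Vec3.

(** * Derivatives and uniform rotations *)

Section Derivatives.
Set Implicit Arguments.
Unset Strict Implicit.
Variable R : realType.
Implicit Types (f g h : R -> R) (F : R -> 'cV[R]_3) (t : R).

Lemma is_derive_colP F t dF :
  is_derive t 1 F dF <-> forall i, is_derive t 1 (fun x => F x i 0) (dF i 0).
Proof.
split=> [[dF' <-] i | H].
  apply: DeriveDef; first exact: (derivable_mxP F t 1).1.
  by rewrite derive_mx// mxE.
have dF' : derivable F t 1.
  by apply/derivable_mxP => i j; rewrite (ord1 j); exact: @ex_derive.
apply: DeriveDef => //; rewrite derive_mx//.
by apply/matrixP => i j; rewrite mxE (ord1 j); exact: derive_val.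
Qed.

Lemma is_derive_vec3 f g h t (dF : 'cV[R]_3) :
  is_derive t 1 f (dF 0 0) -> is_derive t 1 g (dF 1 0) ->
  is_derive t 1 h (dF 2 0) ->
  is_derive t 1 (fun s => vec3 (f s) (g s) (h s)) dF.
Proof.
move=> df dg dh; apply/is_derive_colP; apply: forall_ord3.
- by under eq_fun do rewrite vec3E.
- by under eq_fun do rewrite vec3E.
- by under eq_fun do rewrite vec3E.
Qed.

End Derivatives.

(** Class resolution computes the derivative; its answer contains scalings of R
    by R, which have to become products before ring normalization. *)
Ltac derive_ring := apply: is_derive_eq; rewrite /GRing.scale /=; ring.

Section Rotation.
Set Implicit Arguments.
Unset Strict Implicit.
Variable R : realType.

Lemma sqr_le1_bounds (x : R) : x ^+ 2 <= 1 -> -1 <= x <= 1.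
Proof.
move=> x1; rewrite -ler_norml -(@ler_sqr _ `|x| 1) ?nnegrE//.
by rewrite real_normK ?num_real// expr1n.
Qed.

Lemma polar_coordinates (x y rho : R) : x ^+ 2 + y ^+ 2 = rho ^+ 2 ->
  exists th, x = rho * sin th /\ y = rho * cos th.
Proof.
have [->|rho0] := eqVneq rho 0.
  rewrite expr0n/= => /eqP; rewrite paddr_eq0 ?sqr_ge0// !sqrf_eq0.
  by move=> /andP[/eqP-> /eqP->]; exists 0; rewrite !mul0r.
move=> xy.
have E : (x / rho) ^+ 2 + (y / rho) ^+ 2 = 1.
  by rewrite !expr_div_n -mulrDl xy divff// expf_neq0.
have y1 : -1 <= y / rho <= 1.
  by apply: sqr_le1_bounds; rewrite -E lerDr sqr_ge0.
have Hc : cos (acos (y / rho)) = y / rho by rewrite acosK.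
have /eqP : (x / rho) ^+ 2 = sin (acos (y / rho)) ^+ 2.
  by rewrite sin2cos2 Hc -E; ring.
rewrite eqf_sqr => /orP[/eqP Hs|/eqP Hs].
  by exists (acos (y / rho)); rewrite -Hs Hc; split; field.
exists (- acos (y / rho)); rewrite sinN cosN -Hs Hc; split; field => //.
Qed.

(** Turning the pair back by the angle [Om * t] makes it constant. *)
Lemma rotation_solution (x y : R -> R) (Om rho : R) :
  (forall t : R, is_derive t 1 x (Om * y t)) ->
  (forall t : R, is_derive t 1 y (- Om * x t)) ->
  x 0 ^+ 2 + y 0 ^+ 2 = rho ^+ 2 ->
  exists d, forall t, x t = rho * sin (d + Om * t) /\
                      y t = rho * cos (d + Om * t).
Proof.
move=> dx dy /polar_coordinates[d [x0 y0]]; exists d => t.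
have dX (u : R) :
    is_derive u 1 (fun s => x s * cos (Om * s) - y s * sin (Om * s)) 0.
  by derive_ring.
have dY (u : R) :
    is_derive u 1 (fun s => x s * sin (Om * s) + y s * cos (Om * s)) 0.
  by derive_ring.
have /= := is_derive_0_is_cst t 0 dX; have /= := is_derive_0_is_cst t 0 dY.
rewrite mulr0 cos0 sin0 !mulr0 !mulr1 subr0 add0r sinD cosD !mulrDr => Y X.
have unit z : z = z * (cos (Om * t) ^+ 2 + sin (Om * t) ^+ 2).
  by rewrite cos2Dsin2 mulr1.
split.
  rewrite [LHS]unit !mulrA -x0 -y0 -X -Y; ring.
rewrite [LHS]unit mulrN !mulrA -x0 -y0 -X -Y; ring.
Qed.

Lemma horizontal_circleP (p c : 'cV[R]_3) rho :
  horizontal_circle c `|rho| p <->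
  exists th, p = c + rho *: vec3 (sin th) (cos th) 0.
Proof.
split=> [[/= z xy]|[th ->]].
  have /polar_coordinates[th [x y]] :
      (p 0 0 - c 0 0) ^+ 2 + (p 1 0 - c 1 0) ^+ 2 = rho ^+ 2.
    rewrite -[RHS]real_normK ?num_real// -xy sqr_sqrtr//.
    by rewrite addr_ge0 ?sqr_ge0.
  by exists th; apply: col3P; rewrite mxE [X in _ + X]mxE vec3E;
    rewrite -?x -?y ?mulr0 ?z; ring.
split; first by rewrite /= !linE mulr0 addr0.
rewrite !linE -[RHS]sqrtr_sqr -[rho ^+ 2]mulr1 -(cos2Dsin2 th).
by congr Num.sqrt; ring.
Qed.

Lemma range_uniform_rotation (f : R -> 'cV[R]_3) c (rho d Om : R) :
  (forall t, f t = c + rho *: vec3 (sin (d + Om * t)) (cos (d + Om * t)) 0) ->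
  range f `<=` horizontal_circle c `|rho| /\
  (Om != 0 -> range f = horizontal_circle c `|rho|).
Proof.
move=> fE; have sub : range f `<=` horizontal_circle c `|rho|.
  by move=> _ [t _ <-]; apply/horizontal_circleP; exists (d + Om * t).
split=> // Om0; apply/seteqP; split=> // p /horizontal_circleP[th ->].
exists ((th - d) / Om) => //; rewrite fE.
have -> : d + Om * ((th - d) / Om) = th by field.
by [].
Qed.

End Rotation.

(** * Dynamics of a steady precession *)

Section Precession.
Set Implicit Arguments.
Unset Strict Implicit.
Variables (R : realType) (alpha beta nu eta : R).
Implicit Types (g r u : 'cV[R]_3) (th Phi c : R) (M : trajectory R).

(** [arm_gamma] and [arm_axis] are the oblique coordinates of minus the contact
    arm along [g] and [e3].  In these coordinates the arm varies only through
    [g], with a constant coefficient when the inclination is constant. *)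
Definition arm_gamma th : R := beta ^+ 2 / Zfun beta th.

Definition arm_axis th : R := (1 - beta ^+ 2) * cos th / Zfun beta th + alpha.

Lemma rvecE g th : dot g g = 1 -> g 2 0 = cos th ->
  rvec alpha beta g = - (arm_gamma th *: g + arm_axis th *: e3 R).
Proof.
move=> gg g2; have S : g 0 0 ^+ 2 + g 1 0 ^+ 2 = sin th ^+ 2.
  by rewrite sin2cos2 -g2 -gg dotE; ring.
rewrite /rvec S g2 -/(Zfun beta th) /arm_gamma /arm_axis.
by apply: col3P; rewrite !linE ?g2; ring.
Qed.

Lemma Jtensor_mul r u : Jtensor nu eta r *m u =
  vec3 (u 0 0 / eta) (u 1 0 / eta) (nu / eta * u 2 0)
  + dot r r *: u - dot r u *: r.
Proof.
rewrite /Jtensor mulmxBl mulmxDl mul_scalar_mx; congr (_ + _ - _).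
  rewrite /inertia mul_diag_mx.
  by apply: col3P; rewrite !linE /= ; ring.
apply: col3P; rewrite -mulmxA; rewrite [LHS]mxE big_ord1 -/(dot r u);
  rewrite [RHS]mxE mulrC //.
Qed.

(** The coefficient along g x e3 of the equation of motion of a steady precession
    of rate [Phi].  Up to sign, the factor of [Phi ^+ 2 * cos th] is the square of
    [Jfun]. *)
Definition balance th Phi : R :=
  - arm_axis th - Phi ^+ 2 * cos th *
    ((cos th ^+ 2 + nu * sin th ^+ 2) / eta
     + (arm_gamma th + arm_axis th * cos th) ^+ 2).

(** Every term is a multiple of [n] for a reason of symmetry: [r] and [w] lie in
    the plane of [g] and [e3], which the tensor of inertia preserves, while the
    two derivatives are along the normal [n] of this plane, an eigenvector of the
    tensor. *)
Lemma gyroscopic_residual g th Phi (n := cross g (e3 R))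
    (w := Phi *: (e3 R - cos th *: g))
    (r := - (arm_gamma th *: g + arm_axis th *: e3 R)) :
  dot g g = 1 -> g 2 0 = cos th ->
  Jtensor nu eta r *m (- (cos th * Phi ^+ 2) *: n)
  + cross w (Jtensor nu eta r *m w)
  + cross r (cross w (- (arm_gamma th * Phi) *: n)) + cross g r
  = balance th Phi *: n.
Proof.
move=> gg g2; rewrite /n /w /r /balance {n w r} sin2cos2 -g2.
have g0 : g 0 0 ^+ 2 = 1 - g 1 0 ^+ 2 - g 2 0 ^+ 2 by rewrite -gg dotE; ring.
(* The identity is polynomial in g modulo the sphere equation g0. *)
move: (arm_gamma th) (arm_axis th) => A E.
rewrite !Jtensor_mul; apply: col3P; rewrite !linE; ring: g0.
Qed.

(** The angular velocity is the sum of the proper rotation [Phi] about the axis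
    and the precession [- Phi * cos th] about the vertical; these rates cancel in
    the component along the vertical. *)
Definition steady_precession th Phi M := forall t,
  vec_gamma M t 2 0 = cos th /\
  omega M t = Phi *: (e3 R - cos th *: vec_gamma M t).

Lemma kinematics_frame M t : kinematics M ->
  [/\ dot (vec_gamma M t) (vec_gamma M t) = 1,
      vec_a M t = cross (vec_b M t) (vec_gamma M t) &
      vec_b M t = cross (vec_gamma M t) (vec_a M t)].
Proof.
move=> /(_ t)[QQ detQ _ _ _].
have [[_ _ gg] _] := orthonormal_columns QQ.
by have [aE bE] := frame_cross QQ detQ; split.
Qed.

Section SteadyPrecession.
Variables (M : trajectory R) (th Phi : R).
Hypotheses (kinM : kinematics M) (steadyM : steady_precession th Phi M).

Local Notation g := (vec_gamma M).
Local Notation n t := (cross (g t) (e3 R)).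

Lemma steady_contact_arm t :
  contact_arm alpha beta M t = - (arm_gamma th *: g t + arm_axis th *: e3 R).
Proof.
have [gg _ _] := kinematics_frame t kinM.
by apply: rvecE => //; case: (steadyM t).
Qed.

Lemma steady_is_derive_gamma (t : R) : is_derive t 1 g (Phi *: n t).
Proof.
have [_ _ _ _ dg] := kinM t; apply: is_derive_eq.
by rewrite (steadyM t).2; apply: col3P; rewrite !linE; ring.
Qed.

Lemma steady_is_derive_omega (t : R) :
  is_derive t 1 (omega M) (- (cos th * Phi ^+ 2) *: n t).
Proof.
have dg := steady_is_derive_gamma t.
have -> : omega M = fun s => Phi *: (e3 R - cos th *: g s).
  by apply/funext => s; case: (steadyM s).
have d := is_deriveZ Phi
  (is_deriveB (is_derive_cst (e3 R) t 1) (is_deriveZ (cos th) dg)).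
by apply: (is_derive_eq d); apply: col3P; rewrite !linE; ring.
Qed.

Lemma steady_is_derive_arm (t : R) :
  is_derive t 1 (contact_arm alpha beta M) (- (arm_gamma th * Phi) *: n t).
Proof.
have dg := steady_is_derive_gamma t.
rewrite (funext steady_contact_arm).
have d := is_deriveN (is_deriveD (is_deriveZ (arm_gamma th) dg)
  (is_derive_cst (arm_axis th *: e3 R) t 1)).
by apply: (is_derive_eq d); apply: col3P; rewrite !linE; ring.
Qed.

Lemma steady_dynamicsP : dynamics alpha beta nu eta M <->
  forall t, balance th Phi *: n t - multiplier M t *: g t = 0.
Proof.
pose r := contact_arm alpha beta M.
have dynE t : Jtensor nu eta (r t) *m (omega M)^`()%classic t
    + cross (omega M t) (Jtensor nu eta (r t) *m omega M t)
    + cross (r t) (cross (omega M t) (r^`()%classic t)) + cross (g t) (r t)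
    = balance th Phi *: n t.
  have [gg _ _] := kinematics_frame t kinM; have [g2 wE] := steadyM t.
  have dw := steady_is_derive_omega t; have dr := steady_is_derive_arm t.
  rewrite !derive1E (@derive_val _ _ _ _ _ _ _ dw).
  rewrite (@derive_val _ _ _ _ _ _ _ dr).
  by rewrite /r steady_contact_arm wE (gyroscopic_residual _ gg g2).
split=> H t; first by have [_] := H t; rewrite /= dynE.
have dw := steady_is_derive_omega t.
by split; [exact: ex_derive|rewrite /= dynE].
Qed.

(** In the fixed frame the axis has the coordinates
    [(vec_a M t 2 0, vec_b M t 2 0, cos th)], and only the vertical part
    [- cos th * Phi *: g] of the angular velocity moves it. *)
Lemma steady_is_derive_axis (t : R) :
  is_derive t 1 (fun s => vec_a M s 2 0) (cos th * Phi * vec_b M t 2 0) /\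
  is_derive t 1 (fun s => vec_b M s 2 0) (- (cos th * Phi) * vec_a M t 2 0).
Proof.
have [_ aE bE] := kinematics_frame t kinM; have [_ _ da db _] := kinM t.
have [_ wE] := steadyM t.
split.
  apply: is_derive_eq; first exact: ((is_derive_colP _ _ _).1 da 2).
  by rewrite bE wE !linE; ring.
apply: is_derive_eq; first exact: ((is_derive_colP _ _ _).1 db 2).
by rewrite aE wE !linE; ring.
Qed.

Lemma steady_velocity t :
  (attitude M t)^T *m (- cross (omega M t) (contact_arm alpha beta M t)) =
  (arm_gamma th + arm_axis th * cos th) *:
    vec3 (Phi * vec_b M t 2 0) (- Phi * vec_a M t 2 0) 0.
Proof.
have [_ aE bE] := kinematics_frame t kinM; have [_ wE] := steadyM t.
rewrite steady_contact_arm wE; apply: col3P; rewrite mulmx3E !mxE /=.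
- rewrite bE !linE; ring.
- rewrite aE !linE; ring.
- ring.
Qed.

End SteadyPrecession.
End Precession.

(** * Fixed points of the reduced system *)

Section FixedPoints.
Set Implicit Arguments.
Unset Strict Implicit.
Variables (R : realType) (alpha beta nu eta : R) (th : R).
Hypotheses (beta0 : 0 < beta) (s0 : 0 < sin th).

Lemma Zfun_gt0 : 0 < Zfun beta th.
Proof.
by rewrite sqrtr_gt0 ltr_pwDl ?sqr_ge0// mulr_gt0 ?exprn_gt0.
Qed.

(** The two sides are minus the product of the contact arm with the vertical,
    that is, the height of the center of mass. *)
Lemma heightE : Zfun beta th + alpha * cos th =
  arm_gamma beta th + arm_axis alpha beta th * cos th.
Proof.
have Z0 := lt0r_neq0 Zfun_gt0.
have ZZ : Zfun beta th ^+ 2 = beta ^+ 2 * (1 - cos th ^+ 2) + cos th ^+ 2.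
  by rewrite sqr_sqrtr -?sin2cos2// addr_ge0 -?exprMn ?sqr_ge0.
rewrite /arm_gamma /arm_axis.
transitivity (Zfun beta th ^+ 2 / Zfun beta th + alpha * cos th).
  by field.
by rewrite ZZ; field.
Qed.

Hypotheses (nu0 : 0 < nu) (eta0 : 0 < eta).

Lemma Jfun_gt0 : 0 < Jfun alpha beta nu eta th.
Proof.
rewrite sqrtr_gt0 ltr_pwDl ?sqr_ge0// mulr_gt0 ?divr_gt0// ltr_wpDl ?sqr_ge0//.
by rewrite mulr_gt0 ?exprn_gt0.
Qed.

Lemma Jfun_sqr : Jfun alpha beta nu eta th ^+ 2 =
  (cos th ^+ 2 + nu * sin th ^+ 2) / eta +
  (arm_gamma beta th + arm_axis alpha beta th * cos th) ^+ 2.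
Proof.
have := Jfun_gt0; rewrite sqrtr_gt0 => /ltW J0.
by rewrite sqr_sqrtr// heightE mul1r mulrC.
Qed.

Definition precession_rate kappa : R :=
  kappa / (Jfun alpha beta nu eta th * sin th ^+ 2).

Lemma Bfun_gt0 t : 0 < Bfun alpha beta eta t.
Proof. by rewrite ltr_pwDl ?dot_ge0// divr_gt0. Qed.

Lemma reduced_fixed_pointP kappa :
  reduced_fixed_point alpha beta eta kappa (th, 0) <->
  balance alpha beta nu eta th (precession_rate kappa) = 0.
Proof.
have Z0 := lt0r_neq0 Zfun_gt0; have J0 := lt0r_neq0 Jfun_gt0.
have S0 := lt0r_neq0 s0; have B0 := lt0r_neq0 (Bfun_gt0 th).
rewrite /reduced_fixed_point /reduced_field expr0n mulr0 subr0.
set force := _ + _; have -> : force =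
    - sin th * balance alpha beta nu eta th (precession_rate kappa).
  rewrite /force /balance -Jfun_sqr /precession_rate /arm_axis.
  by field; rewrite ?Z0 ?J0 ?S0.
split=> [[/eqP]|->]; last by rewrite !mulr0.
by rewrite !mulf_eq0 invr_eq0 (negPf B0) oppr_eq0 (negPf S0) => /eqP.
Qed.

(** At [cos th = 0] the gyroscopic term and the ellipsoid's part of the
    gravitational torque vanish, and the displaced center of mass is left
    unsupported. *)
Lemma balance_cos_neq0 Phi : alpha != 0 ->
  balance alpha beta nu eta th Phi = 0 -> cos th != 0.
Proof.
move=> alpha0 bal; apply: contra_neq alpha0 => c0.
move: bal; rewrite /balance /arm_axis c0 !mulr0 !mul0r add0r subr0 => /eqP.
by rewrite oppr_eq0 => /eqP.
Qed.

Lemma balance_omega0_sq Phi : cos th != 0 ->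
  balance alpha beta nu eta th Phi = 0 ->
  (sin th * Phi) ^+ 2 = omega0_sq alpha beta nu eta th.
Proof.
move=> c0; have J0 := lt0r_neq0 Jfun_gt0; have Z0 := lt0r_neq0 Zfun_gt0.
have e0 := lt0r_neq0 eta0.
have J20 : Jfun alpha beta nu eta th ^+ 2 != 0 by rewrite expf_neq0.
rewrite /omega0_sq.
have -> : eta * (Zfun beta th + alpha * cos th) ^+ 2 + cos th ^+ 2 +
    nu * sin th ^+ 2 = eta * Jfun alpha beta nu eta th ^+ 2.
  by rewrite Jfun_sqr heightE; field.
rewrite /balance -Jfun_sqr => /eqP; rewrite subr_eq0 => /eqP bal.
have -> : (sin th * Phi) ^+ 2 = sin th ^+ 2 *
    (Phi ^+ 2 * cos th * Jfun alpha beta nu eta th ^+ 2) /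
    (cos th * Jfun alpha beta nu eta th ^+ 2) by field; rewrite ?J0.
by rewrite -bal /arm_axis; field; rewrite J0 e0 Z0.
Qed.

(** A vector orthogonal to [g] which leaves the third component of [g]
    stationary lies in the plane of [g] and [e3], so its component along the
    axis determines it. *)
Lemma steady_omegaE (g w : 'cV[R]_3) Phi :
  dot g g = 1 -> g 2 0 = cos th -> dot w g = 0 -> cross g w 2 0 = 0 ->
  w 2 0 = Phi * sin th ^+ 2 -> w = Phi *: (e3 R - cos th *: g).
Proof.
move=> gg g2; rewrite crossE dotE g2 => wg gw w2; rewrite w2 in wg.
have S : sin th ^+ 2 = g 0 0 ^+ 2 + g 1 0 ^+ 2.
  by rewrite sin2cos2 -g2 -gg dotE; ring.
have S2 : sin th ^+ 2 != 0 by rewrite expf_neq0// lt0r_neq0.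
have horizontal :
    w 0 0 * g 0 0 + w 1 0 * g 1 0 = - (Phi * sin th ^+ 2 * cos th).
  by apply/eqP; rewrite -addr_eq0 wg.
apply: col3P; rewrite !linE ?w2 ?g2; last by rewrite sin2cos2; ring.
(* The horizontal part of w is recovered from its components along and across
   the horizontal part of g. *)
- apply: (mulfI S2).
  transitivity (g 0 0 * (w 0 0 * g 0 0 + w 1 0 * g 1 0)
                - g 1 0 * (g 0 0 * w 1 0 - g 1 0 * w 0 0)).
    by rewrite S; ring.
  by rewrite horizontal gw; ring.
- apply: (mulfI S2).
  transitivity (g 1 0 * (w 0 0 * g 0 0 + w 1 0 * g 1 0)
                + g 0 0 * (g 0 0 * w 1 0 - g 1 0 * w 0 0)).
    by rewrite S; ring.
  by rewrite horizontal gw; ring.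
Qed.

(** Constant inclination fixes the third component of gamma; with the absence
    of spin and the value of [F2] this determines the angular velocity. *)
Lemma motion_over_steady kappa M :
  motion_over alpha beta nu eta kappa (th, 0) M ->
  steady_precession th (precession_rate kappa) M.
Proof.
move=> [[_ spin kin _] F2E stateE].
have J0 := lt0r_neq0 Jfun_gt0; have S0 := lt0r_neq0 s0.
have nutE t : nutation M t = th by case: (stateE t).
have gE t : vec_gamma M t 2 0 = cos th.
  have [gg _ _] := kinematics_frame t kin.
  rewrite -(nutE t) acosK// in_itv/=; apply: sqr_le1_bounds; rewrite -gg dotE.
  by rewrite -!expr2 lerDr addr_ge0 ?sqr_ge0.
move=> t; split=> //.
have [gg _ _] := kinematics_frame t kin.
have w2 : omega M t 2 0 = precession_rate kappa * sin th ^+ 2.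
  by rewrite -(F2E t) /F2 /precession_rate nutE; field; rewrite J0 S0.
have planar : cross (vec_gamma M t) (omega M t) 2 0 = 0.
  have [_ _ _ _ /is_derive_colP/(_ 2)] := kin t.
  rewrite (_ : (fun x => _) = cst (cos th)); last exact/funext.
  by move=> d; rewrite -(@derive_val _ _ _ _ _ _ _ d) derive_cst.
exact: steady_omegaE.
Qed.

(** The product with [n], which is orthogonal to the vertical, eliminates the
    multiplier. *)
Lemma steady_dynamics_balance Phi M : kinematics M ->
  steady_precession th Phi M -> dynamics alpha beta nu eta M ->
  balance alpha beta nu eta th Phi = 0.
Proof.
move=> kin st /(steady_dynamicsP _ _ _ _ kin st)/(_ 0).
have [gg _ _] := kinematics_frame 0 kin; have [g2 _] := st 0.
set n := cross _ _ => E.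
have nn : dot n n = sin th ^+ 2 by rewrite sin2cos2 -g2 -gg /n !linE; ring.
have : dot n (balance alpha beta nu eta th Phi *: n
              - multiplier M 0 *: vec_gamma M 0) =
    balance alpha beta nu eta th Phi * sin th ^+ 2.
  by rewrite -nn /n !linE; ring.
rewrite E [in LHS]dotE !mxE !mulr0 !addr0 => /esym/eqP.
by rewrite mulf_eq0 expf_eq0 (negPf (lt0r_neq0 s0)) andbF orbF => /eqP.
Qed.

End FixedPoints.

(** * Paths of the center of mass and of the contact point *)

Section Circles.
Set Implicit Arguments.
Unset Strict Implicit.
Variables (R : realType) (alpha beta : R) (M : trajectory R) (th Phi : R).
Hypotheses (kinM : kinematics M) (steadyM : steady_precession th Phi M).

Local Notation height := (arm_gamma beta th + arm_axis alpha beta th * cos th).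

Lemma steady_gamma : exists phi0, forall t,
  vec_gamma M t = gamma_of th (phi0 + Phi * t).
Proof.
have [gg _ _] := kinematics_frame 0 kinM; have [g2 _] := steadyM 0.
have dg := steady_is_derive_gamma kinM steadyM.
have dx (t : R) : is_derive t 1 (fun s => vec_gamma M s 0 0)
    (Phi * vec_gamma M t 1 0).
  apply: is_derive_eq; first exact: ((is_derive_colP _ _ _).1 (dg t) 0).
  by rewrite !linE; ring.
have dy (t : R) : is_derive t 1 (fun s => vec_gamma M s 1 0)
    (- Phi * vec_gamma M t 0 0).
  apply: is_derive_eq; first exact: ((is_derive_colP _ _ _).1 (dg t) 1).
  by rewrite !linE; ring.
have S : vec_gamma M 0 0 0 ^+ 2 + vec_gamma M 0 1 0 ^+ 2 = sin th ^+ 2.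
  by rewrite sin2cos2 -g2 -gg dotE; ring.
have [phi0 H] := rotation_solution dx dy S; exists phi0 => t.
have [x y] := H t; have [z _] := steadyM t.
by apply: col3P; rewrite /gamma_of vec3E.
Qed.

Lemma steady_axis : exists d, forall t,
  vec_a M t 2 0 = sin th * sin (d + cos th * Phi * t) /\
  vec_b M t 2 0 = sin th * cos (d + cos th * Phi * t).
Proof.
have d := steady_is_derive_axis kinM steadyM.
apply: rotation_solution (fun t => (d t).1) (fun t => (d t).2) _.
have [QQ _ _ _ _] := kinM 0; have [g2 _] := steadyM 0.
(* The rows of the attitude matrix are orthonormal as well; the third one holds
   the fixed-frame coordinates of the axis. *)
have /matrixP/(_ 2 2) := mulmx1C QQ; rewrite mulmx3E !mxE /= g2 sin2cos2 => E.
by rewrite -[X in X - _]E; ring.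
Qed.

Hypothesis rollM : rolling alpha beta M.
Hypothesis c0 : cos th != 0.

(** The velocity of the center of mass is a constant multiple of the velocity of
    the horizontal projection of the axis. *)
Lemma steady_com : exists C : 'cV[R]_3, forall t,
  com M t = C + (height / cos th) *: vec3 (vec_a M t 2 0) (vec_b M t 2 0) 0.
Proof.
have d := steady_is_derive_axis kinM steadyM.
pose f s := com M s
  - (height / cos th) *: vec3 (vec_a M s 2 0) (vec_b M s 2 0) 0.
exists (f 0) => t; suff -> : f 0 = f t by rewrite subrK.
have df (s : R) : is_derive s 1 f 0.
  have [dc _] := rollM s.
  have dv : is_derive s 1 (fun s => vec3 (vec_a M s 2 0) (vec_b M s 2 0) 0)
      (vec3 (cos th * Phi * vec_b M s 2 0)
            (- (cos th * Phi) * vec_a M s 2 0) 0).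
    apply: is_derive_vec3; rewrite vec3E; [exact: (d s).1|exact: (d s).2|].
    exact: is_derive_cst.
  apply: (is_derive_eq (is_deriveB dc (is_deriveZ (height / cos th) dv))).
  rewrite (steady_velocity _ _ kinM steadyM).
  by apply: col3P; rewrite !linE; field.
have fE i : f 0 i 0 = f t i 0.
  apply: (@is_derive_0_is_cst _ (fun s => f s i 0)) => s.
  by have := (is_derive_colP _ _ _).1 (df s) i; rewrite mxE.
exact: col3P.
Qed.

Hypothesis s0 : 0 < sin th.
Hypothesis beta0 : 0 < beta.

(** The horizontal part of the contact arm is [- arm_axis] times the projection
    of the axis, because [vec_a] and [vec_b] are orthogonal to the vertical. *)
Lemma steady_circles :
  (exists C : 'cV[R]_3, let S := horizontal_circle C `|rho_p beta th| in
    range (contact_point alpha beta M) `<=` S /\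
    (Phi != 0 -> range (contact_point alpha beta M) = S)) /\
  (exists C : 'cV[R]_3, let S := horizontal_circle C `|rho_c alpha beta th| in
    range (com M) `<=` S /\ (Phi != 0 -> range (com M) = S)).
Proof.
have [C comE] := steady_com; have [d axisE] := steady_axis.
have Z0 := Zfun_gt0 beta0 s0.
split.
- exists (vec3 (C 0 0) (C 1 0) 0) => S.
  have [|sub full] := @range_uniform_rotation _ (contact_point alpha beta M)
    (vec3 (C 0 0) (C 1 0) 0) (rho_p beta th) d (cos th * Phi).
    move=> t; have [ax bx] := axisE t.
    have [QQ _ _ _ _] := kinM t; have [_ [_ ag bg]] := orthonormal_columns QQ.
    have ra : dot (contact_arm alpha beta M t) (vec_a M t) =
        - arm_axis alpha beta th * vec_a M t 2 0.
      rewrite (steady_contact_arm _ _ kinM steadyM) -[RHS]subr0.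
      by rewrite -(mulr0 (arm_gamma beta th)) -ag !linE; ring.
    have rb : dot (contact_arm alpha beta M t) (vec_b M t) =
        - arm_axis alpha beta th * vec_b M t 2 0.
      rewrite (steady_contact_arm _ _ kinM steadyM) -[RHS]subr0.
      by rewrite -(mulr0 (arm_gamma beta th)) -bg !linE; ring.
    rewrite /contact_point ra rb comE /rho_p /tan -/(arm_gamma beta th).
    by apply: col3P; rewrite !linE ?ax ?bx; field.
  by split=> // Phi0; apply: full; rewrite mulf_neq0.
- exists C => S.
  have [|sub full] := @range_uniform_rotation _ (com M) C
    (rho_c alpha beta th) d (cos th * Phi).
    move=> t; have [ax bx] := axisE t.
    rewrite comE /rho_c /tan -(heightE alpha beta0 s0).
    by apply: col3P; rewrite !linE ?ax ?bx; field.
  by split=> // Phi0; apply: full; rewrite mulf_neq0.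
Qed.

End Circles.

(** * A motion over each fixed point *)

Section Existence.
Set Implicit Arguments.
Unset Strict Implicit.
Variables (R : realType) (alpha beta nu eta th Phi : R).

(** The fixed horizontal vectors in the body frame, in terms of Euler angles:
    [phi] is the angle of proper rotation and [- psi] the precession angle up to
    a constant.  The third components are the uniform rotation of
    [steady_axis]. *)
Definition precessing_frame (t : R) : 'cV[R]_3 * 'cV[R]_3 :=
  let psi := cos th * Phi * t in let phi := Phi * t in
  (vec3 (- (cos th * sin psi * sin phi) - cos psi * cos phi)
        (- (cos th * sin psi * cos phi) + cos psi * sin phi)
        (sin th * sin psi),
   vec3 (- (cos th * cos psi * sin phi) + sin psi * cos phi)
        (- (cos th * cos psi * cos phi) - sin psi * sin phi)
        (sin th * cos psi)).

(** The center of mass is placed so that the constant of [steady_com] lies on the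
    vertical axis through the origin. *)
Definition precessing_motion : trajectory R := Trajectory
  (fun t => Phi *: (e3 R - cos th *: gamma_of th (Phi * t)))
  (fun t => (precessing_frame t).1)
  (fun t => (precessing_frame t).2)
  (fun t => gamma_of th (Phi * t))
  (fun t => (arm_gamma beta th + arm_axis alpha beta th * cos th) *:
    vec3 (sin th / cos th * sin (cos th * Phi * t))
         (sin th / cos th * cos (cos th * Phi * t)) 1)
  (fun=> 0).

Lemma precessing_steady : steady_precession th Phi precessing_motion.
Proof. by move=> t; rewrite /= vec3E. Qed.

Lemma precessing_kinematics : kinematics precessing_motion.
Proof.
move=> t; have S2 (x : R) : sin x ^+ 2 = 1 - cos x ^+ 2 := sin2cos2 x.
have [S2th S2phi S2psi] := And3 (S2 th) (S2 (Phi * t)) (S2 (cos th * Phi * t)).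
split.
- apply/matrixP => i j; rewrite mulmx3E; move: i; apply: forall_ord3;
  move: j; apply: forall_ord3; rewrite !mxE /=; ring: S2th S2phi S2psi.
- rewrite det_columns /= /gamma_of !linE; ring: S2th S2phi S2psi.
all: apply: is_derive_vec3; rewrite /= /gamma_of !linE; apply: is_derive_eq;
  rewrite /GRing.scale /=; ring: S2th S2phi S2psi.
Qed.

Lemma precessing_rolling : cos th != 0 -> rolling alpha beta precessing_motion.
Proof.
move=> c0 t; have kin := precessing_kinematics; have st := precessing_steady.
split; last first.
  rewrite (steady_contact_arm _ _ kin st) /= dotE /gamma_of !linE.
  have [S2th S2phi] := conj (sin2cos2 th) (sin2cos2 (Phi * t)).
  ring: S2th S2phi.
rewrite (steady_velocity _ _ kin st); apply/is_derive_colP; apply: forall_ord3.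
all: rewrite /= !linE; under eq_fun do rewrite !linE.
all: by apply: is_derive_eq; rewrite /GRing.scale /=; field.
Qed.

Lemma precessing_dynamics : balance alpha beta nu eta th Phi = 0 ->
  dynamics alpha beta nu eta precessing_motion.
Proof.
have [kin st] := (precessing_kinematics, precessing_steady) => bal.
apply/(steady_dynamicsP _ _ _ _ kin st) => t.
by rewrite bal !scale0r subr0.
Qed.

Lemma precessing_motionP : cos th != 0 ->
  balance alpha beta nu eta th Phi = 0 ->
  motion alpha beta nu eta precessing_motion.
Proof.
move=> c0 bal; split; [exact: precessing_dynamics| |
  exact: precessing_kinematics|exact: precessing_rolling] => t.
rewrite /= /gamma_of !linE.
have [S2th S2phi] := conj (sin2cos2 th) (sin2cos2 (Phi * t)).
ring: S2th S2phi.
Qed.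

Lemma precessing_nutation : 0 < th < pi ->
  nutation precessing_motion = fun=> th.
Proof.
move=> /andP[t0 tpi]; apply/funext => t.
by rewrite /nutation /= vec3E cosK// in_itv/= !ltW.
Qed.

End Existence.

(** * The correspondence and the circles *)

Theorem mainTheorem2 (R : realType) (alpha beta nu eta : R)
  (alpha01 : 0 <= alpha <= 1) (beta_gt0 : 0 < beta)
  (nu02 : 0 < nu <= 2) (eta_gt0 : 0 < eta)
  (alpha_neq0 : alpha != 0)
  (kappa th0 : R) (th0_range : 0 < th0 < pi) :
  (* fixed points correspond to the motions of constant inclination *)
  (reduced_fixed_point alpha beta eta kappa (th0, 0) <->
     exists M : trajectory R, motion_over alpha beta nu eta kappa (th0, 0) M) /\
  (reduced_fixed_point alpha beta eta kappa (th0, 0) ->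
   forall M : trajectory R, motion_over alpha beta nu eta kappa (th0, 0) M ->
   exists omega0 phi0 : R,
   [/\ omega0 ^+ 2 = omega0_sq alpha beta nu eta th0,
       forall t, vec_gamma M t = gamma_of th0 (phi0 + omega0 / sin th0 * t),
       exists c : 'cV[R]_3,
         let C := horizontal_circle c `|rho_p beta th0| in
         range (contact_point alpha beta M) `<=` C /\
         (omega0 != 0 -> range (contact_point alpha beta M) = C) &
       exists c : 'cV[R]_3,
         let C := horizontal_circle c `|rho_c alpha beta th0| in
         range (com M) `<=` C /\
         (omega0 != 0 -> range (com M) = C)]).
Proof.
have /andP[nu0 _] := nu02; have /andP[th_gt0 th_ltpi] := th0_range.
have s0 : 0 < sin th0 by exact: sin_gt0_pi.
set Phi := precession_rate alpha beta nu eta th0 kappa.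
have fixedP : reduced_fixed_point alpha beta eta kappa (th0, 0) <->
    balance alpha beta nu eta th0 Phi = 0 by exact: reduced_fixed_pointP.
have J0 := lt0r_neq0 (Jfun_gt0 alpha beta s0 nu0 eta_gt0).
split; [split|].
- move=> /fixedP bal; have c0 := balance_cos_neq0 alpha_neq0 bal.
  exists (precessing_motion alpha beta th0 Phi); split.
  + exact: precessing_motionP.
  + move=> t; rewrite /F2 precessing_nutation// /= /gamma_of !linE.
    transitivity (Jfun alpha beta nu eta th0 * (Phi * sin th0 ^+ 2)).
      by rewrite sin2cos2; ring.
    by rewrite /Phi /precession_rate; field; rewrite J0 lt0r_neq0.
  + by move=> t; rewrite /reduced_state precessing_nutation// derive1_cst.
- move=> [M over]; apply/fixedP.
  have st := motion_over_steady s0 nu0 eta_gt0 over.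
  by case: over => -[dyn _ kin _] _ _; exact: steady_dynamics_balance st dyn.
- move=> /fixedP bal M over; have c0 := balance_cos_neq0 alpha_neq0 bal.
  have st := motion_over_steady s0 nu0 eta_gt0 over.
  case: over => -[_ _ kin roll] _ _.
  have [phi0 gE] := steady_gamma kin st.
  have [contact centre] := steady_circles kin st roll c0 s0 beta_gt0.
  have Phi0 : sin th0 * Phi != 0 -> Phi != 0.
    by rewrite mulf_eq0 negb_or => /andP[].
  exists (sin th0 * Phi), phi0; split.
  + exact: balance_omega0_sq.
  + by move=> t; rewrite gE (mulrAC (sin th0)) divff ?mul1r// lt0r_neq0.
  + by have [C [sub full]] := contact; exists C; split=> // /Phi0.
  + by have [C [sub full]] := centre; exists C; split=> // /Phi0.
Qed.
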